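(* Let $m,n\geq 2$ be integers, let $\mathcal{C}_{m,n}=\operatorname{SPC}(m)\otimes\operatorname{SPC}(n)$, and write its one-variable weight enumerator as $W_{\mathcal{C}_{m,n}}(z)=\sum_{w=0}^{mn}A_wz^w$. For $0\leq r\leq m$ and $0\leq t\leq n$ put $$Z(r,t)=rt+(m-r)(n-t),\qquad O(r,t)=r(n-t)+(m-r)t.$$ Then, for every integer $0\leq w\leq mn$, $$A_w=\frac{1}{2^{m+n}}\sum_{r=0}^{m}\binom{m}{r}\sum_{t=0}^{n}\binom{n}{t}\sum_{u=\max\{0,\,w-Z(r,t)\}}^{\min\{w,\,O(r,t)\}}(-1)^u\binom{Z(r,t)}{w-u}\binom{O(r,t)}{u}.$$
   Context: For $\ell\geq 2$, $\operatorname{SPC}(\ell)=\{\mathbf{x}\in\mathbb{F}_2^\ell:\sum_{i=1}^{\ell}x_i=0\}$ is the binary single parity-check code of length $\ell$. For binary linear codes $C_1,C_2$ with generator matrices $G_1,G_2$, the product code $C_1\otimes C_2$ is the linear code generated by the Kronecker product $G_1\otimes G_2$. Arranging coordinates row by row, $\mathcal{C}_{m,n}=\operatorname{SPC}(m)\otimes\operatorname{SPC}(n)$ is the $\mathbb{F}_2$-linear space of all $m\times n$ matrices over $\mathbb{F}_2$ in which every row and every column has even Hamming weight; its length is $mn$. For a linear code $\mathcal{C}$ of length $N$, the one-variable weight enumerator is $W_{\mathcal{C}}(z)=\sum_{w=0}^{N}A_w z^w$, where $A_w$ is the number of codewords of $\mathcal{C}$ of Hamming weight $w$ (number of nonzero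 entries). *)

(* Defs.v *)
From HB Require Import structures.
From mathcomp Require Import all_boot all_order all_algebra.
From mathcomp Require Export mxtens.

Set Implicit Arguments.
Unset Strict Implicit.
Unset Printing Implicit Defensive.

Import GRing.Theory.
Local Open Scope ring_scope.

(* Words are row vectors over 'F_2; a binary linear code of length N is a
   subspace {vspace 'rV['F_2]_N}. *)

Definition coord_sum (l : nat) (x : 'rV['F_2]_l) : ('F_2)^o := \sum_(i < l) x 0 i.

Lemma coord_sum_is_linear (l : nat) : linear (@coord_sum l).
Proof.
move=> a x y; rewrite /coord_sum scaler_sumr -big_split /=.
by apply: eq_bigr => i _; rewrite !mxE.
Qed.

HB.instance Definition _ (l : nat) :=
  GRing.isLinear.Build 'F_2 'rV['F_2]_l ('F_2)^o _ (@coord_sum l)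
    (@coord_sum_is_linear l).

Definition SPC (l : nat) : {vspace 'rV['F_2]_l} := lker (linfun (@coord_sum l)).

Lemma mem_SPC (l : nat) (x : 'rV['F_2]_l) :
  (x \in SPC l) = (\sum_(i < l) x 0 i == 0).
Proof. by rewrite memv_ker lfunE. Qed.

Definition code_of_rows (k N : nat) (G : 'M['F_2]_(k, N)) : {vspace 'rV['F_2]_N} :=
  <<[seq row i G | i <- enum 'I_k]>>%VS.

Definition generator_matrix (k N : nat) (C : {vspace 'rV['F_2]_N})
    (G : 'M['F_2]_(k, N)) : bool :=
  basis_of C [seq row i G | i <- enum 'I_k].

Definition gen_mx (N : nat) (C : {vspace 'rV['F_2]_N}) : 'M['F_2]_(\dim C, N) :=
  \matrix_(i < \dim C) (vbasis C)`_i.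

(* [*t] is the Kronecker product: coordinate i * N2 + j of a word of length
   N1 * N2 is entry (i, j) of the N1 x N2 array, i.e. arrays are read row by row.
   The particular generator matrices used do not matter, see [prod_codeE]. *)
Definition prod_code (N1 N2 : nat) (C1 : {vspace 'rV['F_2]_N1})
    (C2 : {vspace 'rV['F_2]_N2}) : {vspace 'rV['F_2]_(N1 * N2)} :=
  code_of_rows (gen_mx C1 *t gen_mx C2).

Definition hamming_weight (N : nat) (x : 'rV['F_2]_N) : nat :=
  #|[set i : 'I_N | x 0 i != 0]|.

Definition weight_count (N : nat) (C : {vspace 'rV['F_2]_N}) (w : nat) : nat :=
  #|[set x : 'rV['F_2]_N | (x \in C) && (hamming_weight x == w)]|.

(* Rational coefficients, because the closed formula for them divides by a
   power of 2. *)
Definition weight_enumerator (N : nat) (C : {vspace 'rV['F_2]_N}) : {poly rat} :=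
  \sum_(w < N.+1) (weight_count C w)%:R *: 'X^w.

Definition Zfun (m n r t : nat) : nat :=
  (r * t + (m - r) * (n - t))%N.

Definition Ofun (m n r t : nat) : nat :=
  (r * (n - t) + (m - r) * t)%N.

Lemma gen_mxP (N : nat) (C : {vspace 'rV['F_2]_N}) : generator_matrix C (gen_mx C).
Proof.
rewrite /generator_matrix.
suff -> : [seq row i (gen_mx C) | i <- enum 'I_(\dim C)] = vbasis C
  by exact: vbasisP.
apply: (@eq_from_nth _ 0); first by rewrite size_map size_enum_ord size_tuple.
move=> i; rewrite size_map size_enum_ord => lti.
rewrite (nth_map (Ordinal lti)) ?size_enum_ord // rowK.
by rewrite nth_enum_ord.
Qed.

Lemma mem_code_of_rows (k N : nat) (G : 'M['F_2]_(k, N)) (x : 'rV['F_2]_N) :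
  (x \in code_of_rows G) = (x <= G)%MS.
Proof.
apply/idP/submxP => [|[D ->]]; last first.
  rewrite mulmx_sum_row; apply: memv_suml => i _; apply: memvZ.
  by apply: memv_span; apply: map_f; rewrite mem_enum.
move=> xG; apply/submxP.
rewrite (coord_span (X := in_tuple [seq row i G | i <- enum 'I_k]) xG).
apply: summx_sub => i _; apply: scalemx_sub.
have /mapP [j _ ->] : [seq row i G | i <- enum 'I_k]`_i \in
  [seq row i G | i <- enum 'I_k] by rewrite mem_nth.
exact: row_sub.
Qed.

Lemma generator_matrixE (k N : nat) (C : {vspace 'rV['F_2]_N})
    (G : 'M['F_2]_(k, N)) :
  generator_matrix C G -> code_of_rows G = C.
Proof. exact: span_basis. Qed.

Lemma code_of_rows_sub (k1 k2 N : nat) (G : 'M['F_2]_(k1, N))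
    (H : 'M['F_2]_(k2, N)) :
  (code_of_rows G <= code_of_rows H)%VS = (G <= H)%MS.
Proof.
apply/subvP/idP => [sGH | sGH x].
  apply/row_subP => i; rewrite -mem_code_of_rows.
  by apply: sGH; rewrite mem_code_of_rows row_sub.
by rewrite !mem_code_of_rows => /submx_trans; apply.
Qed.

Lemma tensmxS (a1 a2 b1 b2 N1 N2 : nat)
    (G1 : 'M['F_2]_(a1, N1)) (H1 : 'M['F_2]_(b1, N1))
    (G2 : 'M['F_2]_(a2, N2)) (H2 : 'M['F_2]_(b2, N2)) :
  (G1 <= H1)%MS -> (G2 <= H2)%MS -> (G1 *t G2 <= H1 *t H2)%MS.
Proof.
by move=> /submxP [A ->] /submxP [B ->]; rewrite -tensmx_mul submxMl.
Qed.

Lemma prod_codeE (k1 k2 N1 N2 : nat)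
    (C1 : {vspace 'rV['F_2]_N1}) (C2 : {vspace 'rV['F_2]_N2})
    (G1 : 'M['F_2]_(k1, N1)) (G2 : 'M['F_2]_(k2, N2)) :
  generator_matrix C1 G1 -> generator_matrix C2 G2 ->
  prod_code C1 C2 = code_of_rows (G1 *t G2).
Proof.
move=> /generator_matrixE g1 /generator_matrixE g2.
have h1 := generator_matrixE (gen_mxP C1).
have h2 := generator_matrixE (gen_mxP C2).
apply/eqP; rewrite eqEsubv /prod_code !code_of_rows_sub.
by rewrite !tensmxS // -code_of_rows_sub ?g1 ?h1 ?g2 ?h2 subvv.
Qed.

Lemma coef_weight_enumerator (N : nat) (C : {vspace 'rV['F_2]_N}) (w : nat) :
  (w <= N)%N -> (weight_enumerator C)`_w = (weight_count C w)%:R.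
Proof.
move=> lewN; rewrite /weight_enumerator coef_sum.
rewrite (bigD1 (Ordinal (lewN : (w < N.+1)%N))) //= coefZ coefXn eqxx mulr1.
rewrite big1 ?addr0 // => i neq; rewrite coefZ coefXn.
case: eqP => [e|]; rewrite ?mulr0 //.
by case/eqP: neq; apply: val_inj.
Qed.

(* Main.v *)
Require Import Defs.
From mathcomp Require Import all_boot all_order all_algebra.

Set Implicit Arguments.
Unset Strict Implicit.
Unset Printing Implicit Defensive.

Import GRing.Theory.
Local Open Scope ring_scope.

(* The word x, read as an m x n array, lies in the product code iff all its row
   sums and column sums vanish; each of these m + n conditions is detected by
   the sign character chi of F_2, as 1 + chi s is 2 if s = 0 and 0 otherwise.
   Expanding the m + n factors gives a sum over sets A of rows and B of columns,
   and for fixed A, B the sum over x factors over the entries: entry (i, j)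
   contributes 1 + z if (i in A) = (j in B) and 1 - z otherwise. With r = |A| and
   t = |B| this is (1 + z)^Z(r,t) (1 - z)^O(r,t). *)

(** * Product codes as spaces of arrays *)

Definition array (R : Type) (m n : nat) (x : 'rV[R]_(m * n)) : 'M[R]_(m, n) :=
  \matrix_(i, j) x 0 (mxtens_index (i, j)).

Lemma array_inj (R : Type) (m n : nat) : injective (@array R m n).
Proof.
move=> x y /matrixP exy; apply/rowP => k.
by case: (mxtens_indexP k) => i j; have := exy i j; rewrite !mxE.
Qed.

Lemma array_surj (R : Type) (m n : nat) (A : 'M[R]_(m, n)) :
  exists x, array x = A.
Proof.
exists (\row_k A (mxtens_unindex k).1 (mxtens_unindex k).2).
by apply/matrixP => i j; rewrite !mxE mxtens_indexK.
Qed.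

Lemma big_mxtens (R : Type) (idx : R) (op : Monoid.com_law idx) (m n : nat)
    (F : 'I_(m * n) -> R) :
  \big[op/idx]_k F k = \big[op/idx]_i \big[op/idx]_j F (mxtens_index (i, j)).
Proof.
rewrite pair_big (reindex (@mxtens_index m n)) /=.
  by apply: eq_bigr => -[].
exists (@mxtens_unindex m n) => k _; first exact: mxtens_indexK.
exact: mxtens_unindexK.
Qed.

(** Membership in the row space of a Kronecker product thereby becomes a two-sided factorization of
    the array. *)
Lemma array_mul_tens (R : comNzRingType) (k1 k2 m n : nat) (d : 'rV[R]_(k1 * k2))
    (G1 : 'M_(k1, m)) (G2 : 'M_(k2, n)) :
  array (d *m (G1 *t G2)) = G1^T *m array d *m G2.
Proof.
apply/matrixP => i j; rewrite !mxE big_mxtens exchange_big.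
apply: eq_bigr => b _; rewrite mxE mulr_suml; apply: eq_bigr => a _.
by rewrite !mxE !mxtens_indexK /= mulrCA mulrA.
Qed.

Lemma sub_gen_mx (N k : nat) (C : {vspace 'rV['F_2]_N}) (A : 'M_(k, N)) :
  (A <= gen_mx C)%MS = [forall i, row i A \in C].
Proof.
have mem_gen x : (x \in C) = (x <= gen_mx C)%MS.
  by rewrite -mem_code_of_rows (generator_matrixE (gen_mxP C)).
by apply/row_subP/forallP => + i => /(_ i); rewrite mem_gen.
Qed.

Lemma mem_prod_code (m n : nat) (C1 : {vspace 'rV['F_2]_m})
    (C2 : {vspace 'rV['F_2]_n}) (x : 'rV['F_2]_(m * n)) :
  (x \in prod_code C1 C2) =
    [forall i, row i (array x) \in C2] && [forall j, row j (array x)^T \in C1].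
Proof.
rewrite mem_code_of_rows -!sub_gen_mx.
apply/submxP/andP => [[d ->] | [rowsC colsC]].
  by rewrite array_mul_tens !trmx_mul trmxK mulmxA !submxMl.
have [Q rowE] : exists Q, array x *m Q *m gen_mx C2 = array x.
  by exists (pinvmx (gen_mx C2)); rewrite mulmxKpV.
have [P colE] : exists P, (array x)^T *m P *m gen_mx C1 = (array x)^T.
  by exists (pinvmx (gen_mx C1)); rewrite mulmxKpV.
(* With X the array, the columns give X = [(gen_mx C1)^T *m P^T *m X]. Replacing the X on the right
   by [X *m Q *m gen_mx C2] leaves [P^T *m X *m Q] as the coefficient array. *)
have [d Dd] := array_surj (P^T *m array x *m Q).
exists d; apply: array_inj; rewrite array_mul_tens Dd !mulmxA.
suff -> : (gen_mx C1)^T *m P^T *m array x = array x by rewrite rowE.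
by apply: trmx_inj; rewrite !trmx_mul !trmxK mulmxA.
Qed.

(** * The sign character of ['F_2] *)

Lemma F2_cases (a : 'F_2) : a = 0 \/ a = 1.
Proof. by case: a => [[|[|]]] // lt; [left | right]; apply: val_inj. Qed.

Definition chi (R : pzRingType) (a : 'F_2) : R := if a == 0 then 1 else -1.

Lemma chiD (R : pzRingType) : {morph chi R : a b / a + b >-> a * b}.
Proof.
move=> a b; rewrite /chi.
by case: (F2_cases a) (F2_cases b) => -> [] -> /=; rewrite ?mulrNN ?mul1r ?mulr1.
Qed.

Lemma chi_sum (R : pzRingType) (I : Type) (s : seq I) (F : I -> 'F_2) :
  chi R (\sum_(i <- s) F i) = \prod_(i <- s) chi R (F i).
Proof. exact: (big_morph (chi R) (chiD R)). Qed.

Lemma prod_1Dchi (R : comNzRingType) (I : finType) (F : I -> 'F_2) :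
  \prod_i (1 + chi R (F i)) = 2 ^+ #|I| * [forall i, F i == 0]%:R.
Proof.
case: forallP => [F0 | /forallP]; last first.
  rewrite negb_forall => /existsP[i Fi0].
  by rewrite (bigD1 i) //= /chi (negPf Fi0) subrr mul0r mulr0.
by rewrite mulr1 -prodr_const; apply: eq_bigr => i _; rewrite /chi (eqP (F0 i)).
Qed.

Lemma prod_1Dchi_expand (R : comNzRingType) (I : finType) (F : I -> 'F_2) :
  \prod_i (1 + chi R (F i)) =
  \sum_(A : {set I}) \prod_i (if i \in A then chi R (F i) else 1).
Proof. by under eq_bigr do rewrite addrC; exact: bigA_distr. Qed.

Lemma sum_F2 (R : nmodType) (F : 'F_2 -> R) : \sum_a F a = F 0 + F 1.
Proof.
rewrite (bigD1 0) //= (big_pred1 1) // => a.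
by case: (F2_cases a) => ->.
Qed.

(** * Sums over subsets and binomial coefficients *)

Lemma prod_if_mem (R : comPzRingType) (n : nat) (A : {set 'I_n}) (a b : R) :
  \prod_i (if i \in A then a else b) = a ^+ #|A| * b ^+ (n - #|A|).
Proof.
have -> : (n - #|A| = #|~: A|)%N by rewrite [RHS]cardsCs setCK card_ord.
rewrite (bigID [in A]) /= -!prodr_const.
congr (_ * _); first by apply: eq_bigr => i ->.
by apply: eq_big => i; rewrite ?inE // => /negPf->.
Qed.

Lemma sum_set_card (R : pzRingType) (n : nat) (F : nat -> R) :
  \sum_(A : {set 'I_n}) F #|A| = \sum_(0 <= r < n.+1) 'C(n, r)%:R * F r.
Proof.
have cardA (A : {set 'I_n}) : (#|A| < n.+1)%N.
  by rewrite ltnS -[leqRHS]card_ord max_card.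
(* Subsets are grouped by cardinality; [cardA] ensures that [inord] keeps its value. *)
rewrite big_mkord (partition_big (fun A : {set 'I_n} => inord #|A| : 'I_n.+1) xpredT) //.
apply: eq_bigr => r _; have := card_draws 'I_n r; rewrite card_ord => <-.
rewrite mulr_natl -sumr_const; apply: eq_big => A.
  by rewrite inE -val_eqE /= inordK.
by rewrite -val_eqE /= inordK // => /eqP->.
Qed.

Lemma coef_1DZX_exp (R : comNzRingType) (a : R) (k u : nat) :
  ((1 + a *: 'X) ^+ k)`_u = a ^+ u * 'C(k, u)%:R.
Proof.
rewrite exprDn coef_sum.
under eq_bigr do rewrite expr1n mul1r exprZn coefMn coefZ coefXn.
have [leuk | ltku] := leqP u k; last first.
  rewrite bin_small // mulr0 big1 // => i _.
  by rewrite (gtn_eqF (leq_trans (ltn_ord i) ltku)) mulr0 mul0rn.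
rewrite (bigD1 (Ordinal (leuk : (u < k.+1)%N))) //= eqxx mulr1 big1 ?addr0.
  by rewrite mulr_natr.
by move=> i; rewrite -val_eqE /= eq_sym => /negPf->; rewrite mulr0 mul0rn.
Qed.

(** In the convolution, u is the degree taken from [(1 - 'X) ^+ O]. The indices [u <= w] left out
    satisfy [O < u] or [Z < w - u], so one binomial coefficient vanishes. *)
Lemma coef_1DX_1BX (R : comNzRingType) (Z O w : nat) :
  (((1 + 'X) ^+ Z * (1 - 'X) ^+ O : {poly R}))`_w =
  \sum_((w - Z)%N <= u < (minn w O).+1)
    (-1) ^+ u * 'C(Z, w - u)%:R * 'C(O, u)%:R.
Proof.
(* Both factors are put in the form [1 + a *: 'X], with a = 1 and a = -1. *)
rewrite -[X in 1 + X]scale1r -scaleN1r coefMr.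
under eq_bigr do rewrite !coef_1DZX_exp expr1n mul1r mulrCA mulrA.
rewrite -(big_mkord xpredT (fun u => (-1) ^+ u * 'C(Z, w - u)%:R * 'C(O, u)%:R)).
have lew : ((minn w O).+1 <= w.+1)%N by rewrite ltnS geq_minl.
rewrite (big_nat_widen _ _ _ _ _ lew) [RHS](@big_nat_widenl _ _ _ _ 0) //.
rewrite [RHS]big_mkcond; apply: eq_big_nat => u ltuw.
rewrite ltnS leq_min; case: ifP => //= /negbT; rewrite !negb_and -!ltnNge.
rewrite [(w < u)%N]ltnNge -ltnS (andP ltuw).2 /= => /orP[ltOu | ltuwZ].
  by rewrite (bin_small ltOu) mulr0.
by rewrite (@bin_small Z) ?mulr0 ?mul0r // ltn_subRL addnC -ltn_subRL.
Qed.

(** * The weight enumerator as a character sum *)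

Lemma weight_enumeratorE (N : nat) (C : {vspace 'rV['F_2]_N}) :
  weight_enumerator C = \sum_(x in C) 'X^(hamming_weight x).
Proof.
have wtlt x : (@hamming_weight N x < N.+1)%N.
  by rewrite ltnS -[leqRHS]card_ord max_card.
rewrite (partition_big (fun x => inord (hamming_weight x) : 'I_N.+1) xpredT) //.
apply: eq_bigr => w _; rewrite /weight_count scaler_nat -sumr_const.
apply: eq_big => x; rewrite inE.
  by rewrite -[inord _ == w]val_eqE /= inordK.
by case/andP => _ /eqP->.
Qed.

(** Used to trade the sum over codewords for an unrestricted sum over all words. *)
Lemma prod_code_SPC_mem (R : comNzRingType) (m n : nat) (x : 'rV['F_2]_(m * n)) :
  2 ^+ (m + n) * (x \in prod_code (SPC m) (SPC n))%:R =
  (\prod_i (1 + chi R (\sum_j array x i j))) *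
  \prod_j (1 + chi R (\sum_i array x i j)).
Proof.
rewrite !prod_1Dchi !card_ord mulrACA -exprD -natrM mulnb mem_prod_code.
congr (_ * (_ && _)%:R); apply: eq_forallb => i; rewrite mem_SPC.
  by under eq_bigr do rewrite mxE.
by under eq_bigr do rewrite !mxE; under [in RHS]eq_bigr do rewrite mxE.
Qed.

(** The entries of a word are chosen independently, so expanding the product of sums picks out each
    word once. *)
Lemma prod_array_sum (R : comNzRingType) (m n : nat) (F : 'I_m -> 'I_n -> 'F_2 -> R) :
  \sum_(x : 'rV['F_2]_(m * n)) \prod_i \prod_j F i j (array x i j) =
  \prod_i \prod_j (F i j 0 + F i j 1).
Proof.
under [RHS]eq_bigr do under eq_bigr do rewrite -sum_F2.
transitivity (\prod_k \sum_a F (mxtens_unindex k).1 (mxtens_unindex k).2 a).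
  (* Distributivity produces choice functions, which correspond bijectively to row vectors. *)
  rewrite bigA_distr_bigA (reindex (fun f : {ffun 'I_(m * n) -> 'F_2} => \row_k f k)).
    apply: eq_bigr => f _; rewrite big_mxtens; apply: eq_bigr => i _.
    by apply: eq_bigr => j _; rewrite !mxE mxtens_indexK.
  exists (fun x : 'rV['F_2]_(m * n) => [ffun k => x 0 k]) => x _.
    by apply/ffunP => k; rewrite ffunE mxE.
  by apply/rowP => k; rewrite mxE ffunE.
rewrite big_mxtens; apply: eq_bigr => i _; apply: eq_bigr => j _.
by rewrite mxtens_indexK.
Qed.

Lemma exp_hamming_weight (R : comNzRingType) (m n : nat) (z : R)
    (x : 'rV['F_2]_(m * n)) :
  z ^+ hamming_weight x = \prod_i \prod_j (if array x i j == 0 then 1 else z).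
Proof.
transitivity (\prod_k (if x 0 k == 0 then 1 else z)).
  by rewrite -prodr_const big_mkcond; apply: eq_bigr => k _; rewrite inE; case: eqP.
by rewrite big_mxtens; do 2 apply: eq_bigr => ? _; rewrite mxE.
Qed.

(** Memberships agree on A x B and on the product of the complements, which together have [Zfun]
    cells; the other [Ofun] cells give b. *)
Lemma prod_signs (R : comNzRingType) (m n : nat) (A : {set 'I_m}) (B : {set 'I_n})
    (a b : R) :
  \prod_i \prod_j (if (i \in A) == (j \in B) then a else b) =
  a ^+ Zfun m n #|A| #|B| * b ^+ Ofun m n #|A| #|B|.
Proof.
transitivity (\prod_i if i \in A then a ^+ #|B| * b ^+ (n - #|B|)
                       else b ^+ #|B| * a ^+ (n - #|B|)).
  apply: eq_bigr => i _; rewrite -!prod_if_mem.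
  by case: (i \in A); apply: eq_bigr => j _; case: (j \in B).
rewrite prod_if_mem !exprMn -!exprM /Zfun /Ofun !exprD.
rewrite !(mulnC #|A|) !(mulnC (m - #|A|)%N).
by rewrite [X in _ * X = _]mulrC mulrACA.
Qed.

Lemma weight_enumerator_prod_SPC (m n : nat) :
  2 ^+ (m + n) * weight_enumerator (prod_code (SPC m) (SPC n)) =
  \sum_(0 <= r < m.+1) 'C(m, r)%:R * \sum_(0 <= t < n.+1) 'C(n, t)%:R *
    ((1 + 'X) ^+ Zfun m n r t * (1 - 'X) ^+ Ofun m n r t).
Proof.
transitivity (\sum_(A : {set 'I_m}) \sum_(B : {set 'I_n})
    ((1 + 'X) ^+ Zfun m n #|A| #|B| * (1 - 'X) ^+ Ofun m n #|A| #|B| : {poly rat})).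
  rewrite weight_enumeratorE big_mkcond mulr_sumr.
  pose term (x : 'rV['F_2]_(m * n)) (A : {set 'I_m}) (B : {set 'I_n}) : {poly rat} :=
    (\prod_i if i \in A then chi _ (\sum_j array x i j) else 1) *
    (\prod_j if j \in B then chi _ (\sum_i array x i j) else 1) *
    'X^(hamming_weight x).
  transitivity (\sum_x \sum_A \sum_B term x A B).
    apply: eq_bigr => x _.
    rewrite -mulrb -[_ *+ nat_of_bool _]mulr_natl mulrA prod_code_SPC_mem.
    rewrite !prod_1Dchi_expand big_distrlr /= mulr_suml.
    by apply: eq_bigr => A _; rewrite mulr_suml.
  rewrite exchange_big; apply: eq_bigr => A _.
  rewrite exchange_big; apply: eq_bigr => B _.
  rewrite -prod_signs.
  pose e (c : bool) (a : 'F_2) : {poly rat} := if c then chi _ a else 1.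
  (* [F i j a] collects all that entry (i, j) contributes when its value is a: its share of the row
     sign, of the column sign and of the weight. *)
  pose F i j a := e (i \in A) a * e (j \in B) a * (if a == 0 then 1 else 'X).
  transitivity (\sum_(x : 'rV['F_2]_(m * n)) \prod_i \prod_j F i j (array x i j)).
    apply: eq_bigr => x _; rewrite /term exp_hamming_weight /F.
    (* The three shares are separated again; the column signs need the product over j outermost
       before [chi_sum] applies. *)
    under [RHS]eq_bigr do rewrite !big_split.
    rewrite !big_split /=; congr (_ * _ * _); last rewrite exchange_big.
      apply: eq_bigr => i _; rewrite /e; case: ifP => _; last by rewrite big1.
      by rewrite chi_sum.
    apply: eq_bigr => j _; rewrite /e; case: ifP => _; last by rewrite big1.
    by rewrite chi_sum.
  (* Value 0 contributes 1. Value 1 contributes ['X] with one sign for each of the two memberships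
     that holds, and two signs cancel. *)
  rewrite prod_array_sum; do 2 apply: eq_bigr => ? _; rewrite /F /e /chi.
  by do 2 case: (_ \in _); rewrite /= ?mulrNN ?mulr1 ?mul1r ?mulN1r.
transitivity (\sum_(A : {set 'I_m}) \sum_(0 <= t < n.+1) 'C(n, t)%:R *
    ((1 + 'X) ^+ Zfun m n #|A| t * (1 - 'X) ^+ Ofun m n #|A| t : {poly rat})).
  by apply: eq_bigr => A _; rewrite -sum_set_card.
by rewrite -sum_set_card.
Qed.

(* The lower limit w - Zfun m n r t is truncated subtraction, that is,
   max {0, w - Z(r, t)}. *)
Theorem corollary3 (m n : nat) (hm : (2 <= m)%N) (hn : (2 <= n)%N)
    (w : nat) (hw : (w <= m * n)%N) :
  (weight_enumerator (prod_code (SPC m) (SPC n)))`_w =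
  (1 / 2 ^+ (m + n)) *
  \sum_(0 <= r < m.+1) 'C(m, r)%:R *
  \sum_(0 <= t < n.+1) 'C(n, t)%:R *
  \sum_((w - Zfun m n r t)%N <= u < (minn w (Ofun m n r t)).+1)
    (-1) ^+ u * 'C(Zfun m n r t, w - u)%:R * 'C(Ofun m n r t, u)%:R.
Proof.
have coefnM k (p : {poly rat}) : (k%:R * p)`_w = k%:R * p`_w.
  by rewrite !mulr_natl coefMn.
have two_neq0 : 2 ^+ (m + n) != 0 :> rat by rewrite expf_neq0.
apply: (mulfI two_neq0); rewrite mulrA mul1r mulfV // mul1r.
(* Read as a natural number, the power of 2 moves inside the coefficient as a constant
   polynomial. *)
rewrite -natrX -coefnM natrX weight_enumerator_prod_SPC coef_sum.
apply: eq_bigr => r _; rewrite coefnM coef_sum; congr (_ * _).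
by apply: eq_bigr => t _; rewrite coefnM coef_1DX_1BX.
Qed.
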